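(* Let $A$ and $B$ be irreducible square matrices of size greater than $1$ with entries in $\{0,1\}$ satisfying condition (I). Suppose that $(X_A,\sigma_A)$ and $(X_B,\sigma_B)$ are continuously orbit equivalent through a homeomorphism $h:X_A\to X_B$, with continuous functions $k_1,l_1:X_A\to\mathbb{Z}_+$ and $k_2,l_2:X_B\to\mathbb{Z}_+$ satisfying $$\sigma_B^{k_1(x)}(h(\sigma_A(x)))=\sigma_B^{l_1(x)}(h(x))\ (x\in X_A),\qquad \sigma_A^{k_2(y)}(h^{-1}(\sigma_B(y)))=\sigma_A^{l_2(y)}(h^{-1}(y))\ (y\in X_B).$$ Put $c_1=l_1-k_1$ and $c_2=l_2-k_2$. Then the isomorphisms $\Psi_h:C(X_B,\mathbb{Z})\to C(X_A,\mathbb{Z})$ and $\Psi_{h^{-1}}:C(X_A,\mathbb{Z})\to C(X_B,\mathbb{Z})$ (defined in the context) extend to continuous linear maps between Banach spaces $$\Psi_h:C(X_B,\mathbb{C})\to C(X_A,\mathbb{C}),\qquad \Psi_{h^{-1}}:C(X_A,\mathbb{C})\to C(X_B,\mathbb{C})$$ which are inverse to each other and such that: (1) $\varphi\mapsto\varphi\circ\Psi_h$ maps the $\sigma_A$-invariant regular Borel positive measures on $X_A$ to $\sigma_B$-invariant regular Borel positive measures on $X_B$, and $\psi\mapsto\psi\circ\Psi_{h^{-1}}$ maps the $\sigma_B$-invariant regular Borel positive measures on $X_B$ to $\sigma_A$-invariant regular Borel positive measures on $X_A$. (2) If $[c_1]=[1]$ in $H^A$, then $\varphi\mapsto\varphi\circ\Psi_h$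 maps the $\sigma_A$-invariant regular Borel probability measures on $X_A$ to $\sigma_B$-invariant regular Borel probability measures on $X_B$; and if $[c_2]=[1]$ in $H^B$, then $\psi\mapsto\psi\circ\Psi_{h^{-1}}$ maps the $\sigma_B$-invariant regular Borel probability measures on $X_B$ to $\sigma_A$-invariant regular Borel probability measures on $X_A$.
   Context: For an $N\times N$ matrix $A$ ($N>1$) with entries in $\{0,1\}$, $X_A=\{(x_n)_{n\ge1}\in\{1,\dots,N\}^{\mathbb{N}}: A(x_n,x_{n+1})=1\ \forall n\ge1\}$ with the product topology, and $\sigma_A:X_A\to X_A$ is the shift $(x_n)_n\mapsto(x_{n+1})_n$. Condition (I) is that of Cuntz and Krieger; for an irreducible matrix it says that $A$ is not a permutation matrix, equivalently $X_A$ has no isolated points. $\mathbb{Z}_+=\{0,1,2,\dots\}$. For $f\in C(X_B,\mathbb{Z})$ (and, by the same formula, for $f\in C(X_B,\mathbb{C})$) and $x\in X_A$, $$\Psi_h(f)(x)=\sum_{i=0}^{l_1(x)-1}f(\sigma_B^i(h(x)))-\sum_{j=0}^{k_1(x)-1}f(\sigma_B^j(h(\sigma_A(x)))),$$ and for $g\in C(X_A,\mathbb{Z})$ (or $C(X_A,\mathbb{C})$) and $y\in X_B$, $$\Psi_{h^{-1}}(g)(y)=\sum_{i=0}^{l_2(y)-1}g(\sigma_A^i(h^{-1}(y)))-\sum_{j=0}^{k_2(y)-1}g(\sigma_A^j(h^{-1}(\sigma_B(y)))).$$ Empty sums are $0$. $C(X,\mathbb{C})$ carries the supremum norm. Regular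 Borel measures on $X_A$ are identified with continuous linear functionals $\varphi\in C(X_A,\mathbb{C})^*$; $\varphi$ is $\sigma_A$-invariant if $\varphi(f\circ\sigma_A)=\varphi(f)$ for all $f\in C(X_A,\mathbb{C})$, positive if $\varphi(f)\ge0$ whenever $f\ge0$, and a probability measure if positive with $\varphi(1)=1$. $H^A=C(X_A,\mathbb{Z})/\{\xi-\xi\circ\sigma_A:\xi\in C(X_A,\mathbb{Z})\}$, with $[\xi]$ the class of $\xi$; likewise $H^B$. *)

(* Defs.v *)
From HB Require Import structures.
From mathcomp Require Import all_boot all_order all_algebra.
From mathcomp Require Import generic_quotient ring_quotient.
From mathcomp Require Import complex.
From mathcomp Require Import all_classical all_reals topology normedtype.
From mathcomp Require Import function_spaces ring.

Set Implicit Arguments.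
Unset Strict Implicit.
Unset Printing Implicit Defensive.

Set Warnings "-redundant-canonical-projection".
Import Quotient Order.TTheory GRing.Theory Num.Theory.

Local Open Scope classical_set_scope.
Local Open Scope ring_scope.
Local Open Scope quotient_scope.

(* [continuousType X Y] under a fresh name: the library may put the
   compact-open topology on the original, whereas the spaces below carry the
   supremum norm. *)
Definition cfun (X Y : topologicalType) : Type := continuousType X Y.
Identity Coercion continuousType_of_cfun : cfun >-> continuousType.

Section cfun_subtype.
Context {X Y : topologicalType}.

Definition is_cts : {pred X -> Y} := mem [set f | continuous f].

HB.instance Definition _ := gen_eqMixin (cfun X Y).
HB.instance Definition _ := gen_choiceMixin (cfun X Y).

Definition mkcfun (f : X -> Y) (f_cts : continuous f) : cfun X Y := mkcts f_cts.

Lemma cfun_cts (f : cfun X Y) : continuous f.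
Proof. exact: cts_fun. Qed.

Let cfun_sub (f : X -> Y) (fP : f \in is_cts) : cfun X Y := mkcfun (set_mem fP).

Let cfun_rect (K : cfun X Y -> Type) :
  (forall f (Pf : f \in is_cts), K (cfun_sub Pf)) -> forall u : cfun X Y, K u.
Proof.
move=> Ksub [f [[Pf]]] /=.
by suff -> : Pf = set_mem (@mem_set _ [set f | continuous f] f Pf)
  by apply: Ksub.
Qed.

Let cfun_valP f (Pf : f \in is_cts) : cfun_sub Pf = f :> (X -> Y).
Proof. by []. Qed.

HB.instance Definition _ := isSub.Build (X -> Y) is_cts (cfun X Y)
  cfun_rect cfun_valP.

End cfun_subtype.

Definition cfun_comp {X Y Z : topologicalType} (g : cfun Y Z) (f : cfun X Y) :
  cfun X Z := (g \o f : continuousType X Z).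

Definition cfun_cst {X Y : topologicalType} (y : Y) : cfun X Y :=
  (cst y : continuousType X Y).

Lemma cfunP {X Y : topologicalType} (f g : cfun X Y) : f = g <-> f =1 g.
Proof. exact: continuousEP. Qed.

Lemma cfun_compE {X Y Z : topologicalType} (g : cfun Y Z) (f : cfun X Y) x :
  cfun_comp g f x = g (f x).
Proof. by []. Qed.

Section cfun_zmod.
Context {X : topologicalType} {V : topologicalZmodType}.

Lemma is_cts_zmod_closed : zmod_closed (@is_cts X V).
Proof.
split=> [|f g /set_mem /= fc /set_mem /= gc]; apply/mem_set => /= x.
  exact: cvg_cst.
apply: (@continuous2_cvg _ V V V _ _ _ _ (fun a b => a - b)).
- exact: (@sub_continuous V (f x, g x)).
- exact: fc.
- exact: gc.
Qed.
HB.instance Definition _ :=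
  GRing.isZmodClosed.Build (X -> V) is_cts is_cts_zmod_closed.
HB.instance Definition _ := [SubChoice_isSubZmodule of cfun X V by <:].

Lemma cfun0 x : (0 : cfun X V) x = 0. Proof. by []. Qed.
Lemma cfunD (f g : cfun X V) x : (f + g) x = f x + g x. Proof. by []. Qed.
Lemma cfunB (f g : cfun X V) x : (f - g) x = f x - g x. Proof. by []. Qed.

End cfun_zmod.

Section cfun_lmod.
Context {X : topologicalType} {K : numFieldType} {V : topologicalLmodType K}.

Lemma is_cts_scaler_closed : scaler_closed (@is_cts X V).
Proof.
move=> a f /set_mem /= fc; apply/mem_set => /= x.
apply: (@continuous2_cvg _ K^o V V _ _ _ _ (fun b v => b *: v)).
- exact: (@scale_continuous K V (a, f x)).
- exact: cvg_cst.
- exact: fc.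
Qed.
HB.instance Definition _ :=
  GRing.isScaleClosed.Build K (X -> V) is_cts is_cts_scaler_closed.
HB.instance Definition _ := [SubZmodule_isSubLmodule of cfun X V by <:].

Lemma cfunZ (a : K) (f : cfun X V) x : (a *: f) x = a *: f x.
Proof. by []. Qed.

End cfun_lmod.

(* discrete topology on the integers, as the library does for [nat] *)
HB.instance Definition _ := hasNbhs.Build int principal_filter.
HB.instance Definition _ := Discrete_ofNbhs.Build int erefl.

Lemma discrete_continuous {X : topologicalType} {D : discreteTopologicalType}
    (f : X -> D) :
  (forall x, nbhs x [set y | f y = f x]) -> continuous f.
Proof.
move=> fP x U; rewrite nbhs_principalE => /principal_filterP Ufx.
by apply: filterS (fP x) => y /= ->.
Qed.

Lemma continuous_discrete {X : topologicalType} {D : discreteTopologicalType}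
    (f : X -> D) x : continuous f -> nbhs x [set y | f y = f x].
Proof. by move=> /(_ x [set f x]); apply; exact: discrete_set1. Qed.

Lemma discrete_precomp {X Y : topologicalType} {D : discreteTopologicalType}
    (g : D -> Y) (f : X -> D) : continuous f -> continuous (g \o f).
Proof.
move=> fc x U /= gfxU; apply: filterS (continuous_discrete x fc) => y /= ->.
exact: nbhs_singleton gfxU.
Qed.

Lemma discrete_precomp2 {X Y : topologicalType} {D E : discreteTopologicalType}
    (g : D -> E -> Y) (f : X -> D) (f' : X -> E) :
  continuous f -> continuous f' -> continuous (fun x => g (f x) (f' x)).
Proof.
move=> fc fc' x U /= gU.
apply: filterS2 (continuous_discrete x fc) (continuous_discrete x fc').
by move=> y /= -> ->; exact: nbhs_singleton gU.
Qed.

Lemma int_sub_continuous : continuous (fun x : int * int => x.1 - x.2).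
Proof.
apply: discrete_continuous => -[a b].
exists ([set a], [set b]); first by split; exact: discrete_set1.
by case=> a' b' [/= -> ->].
Qed.
HB.instance Definition _ :=
  PreTopologicalNmodule_isTopologicalZmodule.Build int int_sub_continuous.

HB.mixin Record isCompactSpace T & Topological T := {
  compact_space : compact [set: T]
}.
#[short(type="compactSpaceType")]
HB.structure Definition CompactSpace := {T of isCompactSpace T & Topological T}.

Section sup_norm.
Context {R : realType} {X : compactSpaceType}.
Local Notation C := (R[i]^o).
Implicit Types f g : cfun X C.

Definition cmod (z : R[i]) : R := complex.Re `|z|.

Definition sup_norm f : R[i] :=
  Complex (sup [set cmod (f x) | x in [set: X]]) 0.

Let le_C0 (x y : R) : (Complex x 0 <= Complex y 0 :> R[i]) = (x <= y).
Proof. by rewrite lecE /= eqxx. Qed.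

Let cmodE (z : R[i]) : Complex (cmod z) 0 = `|z|. Proof. by []. Qed.

Let cmod_cts f : continuous (fun x => cmod (f x) : R^o).
Proof.
move=> x; apply/cvgrPdist_lt => e e0.
have e0' : 0 < Complex e 0 :> R[i] by rewrite ltcE /= eqxx.
move/cvgrPdist_lt: (cfun_cts (x := x) (f := f)) => /(_ _ e0').
apply: filterS => y.
change (`|(f x : R[i]) - f y| < Complex e 0 -> `|cmod (f x) - cmod (f y)| < e).
rewrite -cmodE ltcE /= eqxx /=; apply: le_lt_trans; rewrite -le_C0 cmodE.
apply: le_trans (ler_dist_dist _ _).
rewrite -(cmodE (f x)) -(cmodE (f y)) /Num.norm /= subrr expr0n addr0.
by rewrite sqrtr_sqr.
Qed.

Let cmod_ub f : has_ubound [set cmod (f x) | x in [set: X]].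
Proof.
apply: (@bounded_fun_has_ubound _ R (fun x => cmod (f x))).
have /compact_bounded : compact ((fun x => cmod (f x) : R^o) @` [set: X]).
  apply: continuous_compact; last exact: compact_space.
  exact/continuous_subspaceT/cmod_cts.
by move=> [M [Mr MP]]; exists M; split => // y /MP + x _; apply; exists x.
Qed.

Lemma le_sup_norm f x : `|f x : R[i]| <= sup_norm f.
Proof.
by rewrite -cmodE le_C0; apply: ub_le_sup; [exact: cmod_ub|exists x].
Qed.

Lemma sup_norm_le f (M : R[i]) :
  0 <= M -> (forall x, `|f x : R[i]| <= M) -> sup_norm f <= M.
Proof.
case: M => m m'; rewrite lecE /= => /andP[/eqP -> m0] fM.
rewrite eqxx /=; have [->|/set0P ne] :=
  eqVneq [set cmod (f x) | x in [set: X]] set0; first by rewrite sup0.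
by apply: ge_sup => // _ [x _ <-]; rewrite -le_C0 cmodE; exact: fM.
Qed.

Lemma sup_norm_ge0 f : 0 <= sup_norm f.
Proof.
rewrite lecE /= eqxx /=; have [->|/set0P[_ [x _ _]]] :=
  eqVneq [set cmod (f x) | x in [set: X]] set0; first by rewrite sup0.
apply: (@le_trans _ _ (cmod (f x))); last first.
  by apply: ub_le_sup; [exact: cmod_ub|exists x].
by rewrite -le_C0 cmodE normr_ge0.
Qed.

Let sup_normD f g : sup_norm (f + g) <= sup_norm f + sup_norm g.
Proof.
apply: sup_norm_le => [|x]; first by rewrite addr_ge0 ?sup_norm_ge0.
by apply: le_trans (ler_normD _ _) _; rewrite lerD ?le_sup_norm.
Qed.

Let sup_normZ_le (a : R[i]) f : sup_norm (a *: f) <= `|a| * sup_norm f.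
Proof.
apply: sup_norm_le => [|x]; first by rewrite mulr_ge0 ?sup_norm_ge0.
by rewrite normrM ler_wpM2l ?le_sup_norm.
Qed.

Let sup_normZ (a : R[i]) f : sup_norm (a *: f) = `|a| * sup_norm f.
Proof.
apply/eqP; rewrite eq_le sup_normZ_le /=.
have [->|a0] := eqVneq a 0; first by rewrite normr0 mul0r sup_norm_ge0.
rewrite -ler_pdivlMl ?normr_gt0// -normfV.
by apply: le_trans (sup_normZ_le _ _); rewrite scalerA mulVf// scale1r.
Qed.

Let sup_norm0_eq0 f : sup_norm f = 0 -> f = 0.
Proof.
move=> f0; apply/cfunP => x; apply/eqP.
by rewrite -normr_le0 -f0 le_sup_norm.
Qed.

HB.instance Definition _ := Lmodule_isNormed.Build R[i] (cfun X C)
  sup_normD sup_normZ sup_norm0_eq0.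

Lemma cfun_normE f : `|f| = sup_norm f. Proof. by []. Qed.

End sup_norm.

Section complex_complete.
Context {R : realType}.

Lemma complex_complete (F : set_system R[i]^o) :
  ProperFilter F -> cauchy F -> cvg F.
Proof.
move=> FF /cauchyP Fc.
have norm_le (z : R[i]) : `|complex.Re z| <= complex.Re `|z| /\
    `|complex.Im z| <= complex.Re `|z| /\
    complex.Re `|z| <= `|complex.Re z| + `|complex.Im z|.
  case: z => a b /=; split; first by rewrite -sqrtr_sqr ler_wsqrtr// lerDl sqr_ge0.
  split; first by rewrite -sqrtr_sqr ler_wsqrtr// lerDr sqr_ge0.
  rewrite -[leRHS]ger0_norm ?addr_ge0// -sqrtr_sqr ler_wsqrtr// sqrrD !real_normK ?num_real//.
  by rewrite -addrA lerD2l lerDr mulrn_wge0// mulr_ge0.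
have ball_lt (z w : R[i]^o) (e : R) :
    ball z (Complex e 0) w <-> complex.Re `|(z : R[i]) - w| < e.
  by rewrite /ball /= ltcE /= eqxx.
have coord (p : R[i] -> R) : (forall z w, p (z - w) = p z - p w) ->
    (forall z, `|p z| <= complex.Re `|z|) -> cvg ((p : R[i]^o -> R^o) @ F).
  move=> pB ple; apply: (@cauchy_cvg R^o _ _); apply: (@cauchy_exP R R^o _ _) => e e0.
  have [|z Fz] := Fc (Complex e 0); first by rewrite ltcE /= eqxx.
  exists (p z).
  suff : F [set w | `|p z - p (w : R[i])| < e] by [].
  apply: filterS Fz => w /ball_lt zw.
  by rewrite /= -pB; exact: le_lt_trans (ple _) zw.
have /cvg_ex[a Fa] : cvg ((fun z : R[i]^o => complex.Re (z : R[i]) : R^o) @ F).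
  apply: coord => [[? ?] [? ?]//|z]; exact: (norm_le z).1.
have /cvg_ex[b Fb] : cvg ((fun z : R[i]^o => complex.Im (z : R[i]) : R^o) @ F).
  apply: coord => [[? ?] [? ?]//|z]; exact: (norm_le z).2.1.
apply/cvg_ex; exists (Complex a b); apply/cvgrPdist_lt => -[e e'].
rewrite ltcE /= => /andP[/eqP -> e0].
have e20 : 0 < e / 2 by rewrite divr_gt0.
move/cvgrPdist_lt/(_ _ e20) : Fa; move/cvgrPdist_lt/(_ _ e20) : Fb.
apply: filterS2 => z bz az; apply/ball_lt.
apply: le_lt_trans (norm_le _).2.2 _.
by case: z az bz => x y az bz; rewrite [ltRHS]splitr ltrD.
Qed.

Context {X : compactSpaceType}.

Lemma cfun_complete (F : set_system (cfun X R[i]^o)) :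
  ProperFilter F -> cauchy F -> cvg F.
Proof.
move=> FF /cauchyP Fc.
have evl (f g : cfun X R[i]^o) x (e : R[i]) : ball f e g -> `|(f x : R[i]) - g x| < e.
  by move=> fg; apply: le_lt_trans (le_sup_norm (f - g) x) fg.
have cvgx x : cvg ((fun f : cfun X R[i]^o => f x) @ F).
  apply: complex_complete; apply: (@cauchy_exP R[i] R[i]^o _ _) => e e0.
  have [f Ff] := Fc e e0; exists (f x).
  suff : F [set g : cfun X R[i]^o | `|(f x : R[i]) - g x| < e] by [].
  by apply: filterS Ff => g; exact: evl.
pose g x := lim ((fun f : cfun X R[i]^o => f x) @ F).
have gE (f : cfun X R[i]^o) (e : R[i]) x : 0 < e -> F (ball f e) -> `|(f x : R[i]) - g x| < e + e.
  move=> e0 Ff; have /cvgrPdist_lt/(_ _ e0) gx := cvgx x.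
  have [k [kg kf]] := filter_ex (filterI gx Ff).
  apply: le_lt_trans (ler_distD (k x : R[i]) _ _) _.
  by rewrite ltrD//; [exact: evl|rewrite distrC].
have gc : continuous g.
  move=> x; apply/cvgrPdist_lt => e e0; have e5 : 0 < e / 5 by rewrite divr_gt0.
  have [f Ff] := Fc _ e5.
  have /cvgrPdist_lt/(_ _ e5) := cfun_cts (f := f) (x := x).
  apply: filterS => y fxy.
  apply: le_lt_trans (ler_distD (f x : R[i]) _ _) _.
  have -> : e = (e / 5 + e / 5) + (e / 5 + (e / 5 + e / 5)) by field.
  apply: ltrD; first by rewrite distrC; exact: gE.
  apply: le_lt_trans (ler_distD (f y : R[i]) _ _) _.
  by apply: ltrD => //; exact: gE.
apply/cvg_ex; exists (mkcfun gc); apply/cvgrPdist_lt => e e0.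
have e4 : 0 < e / 4 by rewrite divr_gt0.
have [f Ff] := Fc _ e4; apply: filterS (Ff) => k fk.
apply: (@le_lt_trans _ _ (e / 4 + e / 4 + e / 4)).
  apply: sup_norm_le => [|x]; first by rewrite !addr_ge0 ?(ltW e4).
  apply: le_trans (ler_distD (f x : R[i]) _ _) _.
  apply: lerD; first by rewrite distrC ltW//; exact: gE.
  by rewrite ltW//; exact: evl.
have eE : e = e / 4 + e / 4 + e / 4 + e / 4 by field.
by rewrite [ltRHS]eE ltrDl.
Qed.

HB.instance Definition _ :=
  Uniform_isComplete.Build (cfun X R[i]^o) cfun_complete.

End complex_complete.

(* the inclusion of C(X, Z) into C(X, C) *)
Definition cfun_intr {R : realType} {X : topologicalType} (f : cfun X int) :
    cfun X R[i]^o :=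
  mkcfun (discrete_precomp (g := fun n : int => n%:~R : R[i]^o)
    (cfun_cts (f := f))).

(* l - k *)
Definition cocycle {X : topologicalType} (k l : cfun X nat) : cfun X int :=
  mkcfun (discrete_precomp2 (g := fun m n : nat => m%:Z - n%:Z)
    (cfun_cts (f := l)) (cfun_cts (f := k))).

Section orbit_equivalence.
Context {X Y : Type} (sX : X -> X) (sY : Y -> Y) (h : X -> Y) (k l : X -> nat).

Definition orbit_cocycles : Prop :=
  forall x, iter (k x) sY (h (sX x)) = iter (l x) sY (h x).

Definition Psi {V : zmodType} (f : Y -> V) (x : X) : V :=
  \sum_(0 <= i < l x) f (iter i sY (h x)) -
  \sum_(0 <= j < k x) f (iter j sY (h (sX x))).

End orbit_equivalence.

(* Regular Borel measures on a compact space are taken, via the Riesz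
   representation, as continuous linear functionals on C(X, C). *)
Section measures.
Context {R : realType} {X : compactSpaceType} (s : cfun X X).
Implicit Type phi : {linear cfun X R[i]^o -> R[i]^o}.

Definition invariant_functional phi : Prop :=
  forall f : cfun X R[i]^o, phi (cfun_comp f s) = phi f.

(* 0 <= z in R[i] says that z is a nonnegative real *)
Definition positive_functional phi : Prop :=
  forall f : cfun X R[i]^o, (forall x, 0 <= (f x : R[i])) -> 0 <= (phi f : R[i]).

Definition invariant_positive_measure phi : Prop :=
  [/\ continuous phi, invariant_functional phi & positive_functional phi].

Definition invariant_probability_measure phi : Prop :=
  invariant_positive_measure phi /\ phi (cfun_cst (1 : R[i]^o)) = 1.

End measures.

Section cohomology.
Context {X : topologicalType} (s : cfun X X).

Definition coboundary : {pred cfun X int} :=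
  mem [set f | exists xi : cfun X int, f = xi - cfun_comp xi s].

Lemma coboundary_zmod_closed : zmod_closed coboundary.
Proof.
split=> [|_ _ /set_mem[xi ->] /set_mem[eta ->]]; apply/mem_set.
  by exists 0; apply/cfunP => x; rewrite cfunB !cfun0 subrr.
exists (xi - eta); apply/cfunP => x; rewrite !cfunB !cfun_compE cfunB.
by rewrite !opprB addrACA [RHS]addrACA [in RHS](addrC (- eta x)).
Qed.
HB.instance Definition _ :=
  GRing.isZmodClosed.Build (cfun X int) coboundary coboundary_zmod_closed.

Definition cohomology : zmodType := {quot coboundary}.
Definition cohomology_class (f : cfun X int) : cohomology :=
  \pi_{quot coboundary} f.

End cohomology.

Section shift_space.
Context {N : nat} (A : 'M[nat]_N).

Definition zero_one_mx : Prop := forall i j, A i j = 0%N \/ A i j = 1%N.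

Definition irreducible_mx : Prop :=
  forall i j, exists n, (0 < n)%N /\ (0 < (A ^+ n) i j)%N.

Definition edge : rel 'I_N := fun i j => A i j == 1%N.

(* [s] lists the interior vertices of an edge path from [i] to [i] that does
   not visit [i] in between. *)
Definition simple_return (i : 'I_N) (s : seq 'I_N) : bool :=
  path edge i (rcons s i) && (i \notin s).

(* Cuntz and Krieger, A class of C*-algebras and topological Markov chains:
   every vertex leads to a vertex with two different first-return paths *)
Definition condition_I : Prop :=
  forall i, exists j, connect edge i j /\
    exists s t, [/\ s != t, simple_return j s & simple_return j t].

Definition seq_space : Type :=
  prod_topology (fun _ : nat => discrete_topology 'I_N).
HB.instance Definition _ := Topological.on seq_space.

Definition admissible : set seq_space :=
  [set x | forall n, A (x n) (x n.+1) = 1%N].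

Definition shift_space : Type := set_type admissible.
HB.instance Definition _ := Topological.on shift_space.

Lemma coord_cts n : continuous (fun x : seq_space => x n).
Proof. exact: (@proj_continuous nat (fun=> discrete_topology 'I_N) n). Qed.

Lemma shift_space_val_cts : continuous (fun x : shift_space => val x).
Proof. exact: (@initial_continuous (set_type admissible) seq_space set_val). Qed.

Lemma seq_space_cts (X : topologicalType) (f : X -> seq_space) :
  (forall n, continuous (fun x => f x n)) -> continuous f.
Proof.
move=> fc x; apply/cvg_sup => n U [V [[W oW <-]] Wfx VU].
by apply: filterS (VU) _; apply: (fc n x); exact: open_nbhs_nbhs.
Qed.

Lemma admissible_closed : closed admissible.
Proof.
have -> : admissible =
    \bigcap_(n in [set: nat]) [set x | A (x n) (x n.+1) = 1%N].
  by apply/seteqP; split => x /= xA n; [move=> _; exact: xA|exact: xA].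
apply: closed_bigI => n _ x clx.
have [y [/= yA [yn yn1]]] : [set y | A (y n) (y n.+1) = 1%N] `&`
    ([set y : seq_space | y n = x n] `&` [set y | y n.+1 = x n.+1]) !=set0.
  apply: clx; apply: filterI;
    by apply: (continuous_discrete (D := discrete_topology 'I_N)); exact: coord_cts.
by rewrite /= -yn -yn1.
Qed.

Lemma admissible_compact : compact admissible.
Proof.
apply: (subclosed_compact admissible_closed); last exact: subsetT.
have := @tychonoff nat (fun=> discrete_topology 'I_N) (fun=> setT).
rewrite (_ : [set f | _] = setT); last by apply/seteqP; split.
by apply=> _; exact/finite_compact/finite_finset.
Qed.

Lemma shift_space_compact : compact [set: shift_space].
Proof.
move=> F PF _.
have /admissible_compact : ((fun x : shift_space => val x) @ F) admissible.
  suff : F [set x : shift_space | admissible (val x)] by [].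
  by apply: filterE => x; have /set_mem := valP x.
case=> p [pA clp]; exists (exist _ p (mem_set pA)); split => // U V FU.
case=> W [[O oO <-] /= Op OV].
have [| |_ [[x Ux <-] Ox]] := clp (val @` U) O.
- suff : F [set x : shift_space | (val @` U) (val x)] by [].
  by apply: filterS FU => x Ux; exists x.
- exact: open_nbhs_nbhs.
- by exists x; split => //; exact: OV.
Qed.
HB.instance Definition _ := isCompactSpace.Build shift_space shift_space_compact.

Definition shift_seq (x : seq_space) : seq_space := fun n => x n.+1.

Lemma shift_seq_admissible (x : shift_space) :
  shift_seq (val x) \in admissible.
Proof. by apply/mem_set => n; have /set_mem := valP x; exact. Qed.

Definition shift_fun (x : shift_space) : shift_space :=
  exist (fun y => y \in admissible) (shift_seq (val x))
    (shift_seq_admissible x).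

Lemma shift_fun_cts : continuous shift_fun.
Proof.
apply: continuous_comp_initial; apply: seq_space_cts => n x.
exact: continuous_comp (shift_space_val_cts (x := x)) (coord_cts (n := n.+1) (x := _)).
Qed.

Definition shift_map : cfun shift_space shift_space := mkcfun shift_fun_cts.

End shift_space.

(* Main.v *)
(* Write S_n f for the n-th Birkhoff sum of f. The cocycle identities iterate to
   sigma_B^K (h (sigma_A^n x)) = sigma_B^L (h x) with L = S_n l1 x, K = S_n k1 x, and
   S_n (Psi_h f) x = S_L f (h x) - S_K f (h (sigma_A^n x)).
   - Psi_h and Psi_{h^-1} are mutually inverse: the composite is governed by locally
     constant exponents p, q with sigma_A^p = sigma_A^q on an open set, and p = q because
     condition (I) excludes isolated points.
   - Positivity: at a periodic point z of period n one has S_n k1 z <= S_n l1 z, since z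
     attracts under the inverse branch of sigma_A^n; hence S_n (Psi_h f) z >= 0 for
     f >= 0. A closing argument gives S_n (Psi_h f) >= -(n e + C) everywhere, for every
     e > 0, and an invariant positive functional satisfies
     phi (S_n (Psi_h f)) = n phi (Psi_h f).
   - Invariance and normalisation hold because Psi_h (f - f o sigma_B) =
     f o h - f o h o sigma_A and Psi_h 1 = c_1. *)

From HB Require Import structures.
Require Import Defs.
From mathcomp Require Import all_boot all_order all_algebra.
From mathcomp Require Import ring_quotient complex zify lra.
From mathcomp Require Import all_classical all_reals topology normedtype.

Set Implicit Arguments.
Unset Strict Implicit.
Unset Printing Implicit Defensive.

Import Order.TTheory GRing.Theory Num.Theory.

Local Open Scope classical_set_scope.
Local Open Scope ring_scope.

(** * Birkhoff sums along an orbit *)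

Definition bsum {X : Type} {V : nmodType} (s : X -> X) (f : X -> V) n x :=
  \sum_(0 <= i < n) f (iter i s x).

Section birkhoff_sums.
Context {X : Type} {V : nmodType} (s : X -> X) (f : X -> V).

Lemma bsum0 x : bsum s f 0 x = 0.
Proof. exact: big_geq. Qed.

Lemma bsum1 x : bsum s f 1 x = f x.
Proof. by rewrite /bsum big_nat1. Qed.

Lemma bsumD m n x : bsum s f (m + n) x = bsum s f m x + bsum s f n (iter m s x).
Proof.
rewrite /bsum (@big_cat_nat _ _ _ m) ?leq_addr //= -{2}[m]add0n big_addn addKn.
by congr (_ + _); apply: eq_bigr => i _; rewrite iterD.
Qed.

Lemma bsumS n x : bsum s f n.+1 x = f x + bsum s f n (s x).
Proof. by rewrite -add1n bsumD bsum1. Qed.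

Lemma bsumSr n x : bsum s f n.+1 x = bsum s f n x + f (iter n s x).
Proof. by rewrite -addn1 bsumD bsum1. Qed.

End birkhoff_sums.

(** * Cocycle identities iterated along an orbit *)

Section orbit_equivalence.
Context {X Y : Type} (sX : X -> X) (sY : Y -> Y) (h : X -> Y) (k l : X -> nat).
Hypothesis hkl : orbit_cocycles sX sY h k l.

Lemma PsiE {V : zmodType} (f : Y -> V) x :
  Psi sX sY h k l f x =
  bsum sY f (l x) (h x) - bsum sY f (k x) (h (sX x)).
Proof. by []. Qed.

Lemma orbit_cocycles_iter n x :
  iter (bsum sX k n x) sY (h (iter n sX x)) = iter (bsum sX l n x) sY (h x).
Proof.
elim: n => [|n IHn]; first by rewrite !bsum0.
rewrite !bsumSr iterD iterS hkl -iterD addnC iterD IHn -iterD.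
by rewrite addnC.
Qed.

Lemma bsum_Psi {V : zmodType} (f : Y -> V) n x :
  bsum sX (Psi sX sY h k l f) n x =
  bsum sY f (bsum sX l n x) (h x) -
  bsum sY f (bsum sX k n x) (h (iter n sX x)).
Proof.
elim: n => [|n IHn]; first by rewrite !bsum0 subrr.
set y := iter n sX x; set L := bsum sX l n x; set K := bsum sX k n x.
(* The orbit of [h x] after [L] steps and that of [h y] after [K] steps are at the same point, so
   their next [l y] terms coincide. [e2] uses the one-step identity at [y] in the same way, for [K]
   further terms. *)
have e1 : bsum sY f (L + l y)%N (h x) =
    bsum sY f L (h x) + (bsum sY f (K + l y)%N (h y) - bsum sY f K (h y)).
  by rewrite !bsumD addrAC subrr add0r /K -orbit_cocycles_iter.
have e2 : bsum sY f (l y + K)%N (h y) =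
    bsum sY f (l y) (h y) +
    (bsum sY f (k y + K)%N (h (sX y)) - bsum sY f (k y) (h (sX y))).
  by rewrite !bsumD addrAC subrr add0r hkl.
rewrite !bsumSr IHn PsiE -/y -/L -/K iterS -/y.
(* The lengths are themselves Birkhoff sums in the additive monoid [nat]; unfolding its addition
   exposes the [addn] that [e1] and [e2] are stated with. *)
rewrite [in RHS]/GRing.add /=.
rewrite e1 (addnC K) e2 (addnC K).
move: (bsum sY f L _) (bsum sY f K _) (bsum sY f (l y) _) => a b c.
move: (bsum sY f (k y) _) (bsum sY f (k y + K)%N _) => d e.
rewrite (addrCA c); move: (c - d) => u.
by rewrite -[RHS]addrA (addrAC (e + u)) (addrC e) addrK (addrC u) addrA.
Qed.

(** Birkhoff sums of [f - f \o sY] telescope, and the two orbit segments end at the same point by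
    [hkl]. *)
Lemma Psi_comp {V : zmodType} (f : Y -> V) x :
  Psi sX sY h k l f x - Psi sX sY h k l (f \o sY) x = f (h x) - f (h (sX x)).
Proof.
have tele n y : bsum sY f n y - bsum sY (f \o sY) n y = f y - f (iter n sY y).
  elim: n => [|n IHn]; first by rewrite !bsum0 !subrr.
  by rewrite !bsumSr opprD addrACA IHn /= addrA addrNK.
rewrite !PsiE opprD addrACA -opprD !tele hkl.
by rewrite opprB addrA addrNK.
Qed.

End orbit_equivalence.

(** * Points of a shift space: spliced, periodic and non-isolated points *)

Definition letter {N : nat} {A : 'M[nat]_N} (x : shift_space A) (n : nat) : 'I_N :=
  (val x : @seq_space N) n.

(** [agree n x] is the cylinder of length [n] around [x]. *)
Definition agree {N : nat} {A : 'M[nat]_N} (n : nat) (x y : shift_space A) :=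
  forall m, (m < n)%N -> letter y m = letter x m.

Section shift_points.
Context {N : nat} (A : 'M[nat]_N).
Implicit Types x y z : shift_space A.

Lemma letter_admissible x n : A (letter x n) (letter x n.+1) = 1%N.
Proof. by have /set_mem := valP x; apply. Qed.

Lemma letter_inj x y : letter x =1 letter y -> x = y.
Proof. by move=> xy; apply: val_inj; apply/funext. Qed.

Lemma letter_iter n x m : letter (iter n (shift_map A) x) m = letter x (n + m).
Proof.
elim: n m => [|n IHn] m; first by [].
by rewrite iterS; change (letter (iter n (shift_map A) x) m.+1 = letter x (n.+1 + m));
  rewrite IHn addnS.
Qed.

Definition point_of (c : nat -> 'I_N) (cA : forall n, A (c n) (c n.+1) = 1%N) :
    shift_space A :=
  exist (fun y : @seq_space N => y \in admissible A) c (mem_set cA).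

(** The first [n] letters of [x] are put in front of [y]: this is the inverse branch of the [n]-th
    power of the shift near [x]. *)
Lemma splice x y n : letter x n = letter y 0 ->
  exists2 z, agree n x z & iter n (shift_map A) z = y.
Proof.
move=> xy; pose c m := if (m < n)%N then letter x m else letter y (m - n).
have cA m : A (c m) (c m.+1) = 1%N.
  rewrite /c; case: (ltngtP m.+1 n) => [mn|mn|mn].
  - exact: letter_admissible.
  - by rewrite subSn // letter_admissible.
  - by rewrite mn subnn -xy -mn letter_admissible.
exists (point_of cA) => [m mn|]; first by rewrite /letter /= /c mn.
apply: letter_inj => m; rewrite letter_iter /letter /= /c.
by rewrite ltnNge leq_addr /= addKn.
Qed.

(** Read [c] modulo [n]; the condition [c n = c 0] makes the wrap-around transition admissible. *)
Lemma periodize (c : nat -> 'I_N) n : (0 < n)%N ->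
  (forall m, (m < n)%N -> A (c m) (c m.+1) = 1%N) -> c n = c 0%N ->
  exists2 z, iter n (shift_map A) z = z &
    forall m, (m < n)%N -> letter z m = c m.
Proof.
move=> n0 cA cn; pose d m := c (m %% n)%N.
have dA m : A (d m) (d m.+1) = 1%N.
  have mn := ltn_pmod m n0; rewrite /d -addn1 -modnDml addn1.
  have [mn1|mn1] := ltnP (m %% n).+1 n; first by rewrite (modn_small mn1) cA.
  have {mn1}mn1 : (m %% n).+1 = n by apply/eqP; rewrite eqn_leq mn mn1.
  by rewrite mn1 modnn -cn -[in c n]mn1 cA.
exists (point_of dA) => [|m mn]; last by rewrite /letter /= /d modn_small.
by apply: letter_inj => m; rewrite letter_iter /letter /= /d modnDl.
Qed.

(** A closing lemma: [z] repeats the first [n] letters of [x]. Agreement extends to length [n + D]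
    because in that range each letter of [x] from position [n] on equals the one [n] places
    earlier. *)
Lemma periodic_shadow x n D : (0 < n)%N -> (0 < D)%N ->
  agree D x (iter n (shift_map A) x) ->
  exists2 z, iter n (shift_map A) z = z & agree (n + D) x z.
Proof.
move=> n0 D0 xD.
have [| |z zn zx] := @periodize (letter x) n n0.
- by move=> m _; exact: letter_admissible.
- by rewrite -(xD _ D0) letter_iter addn0.
exists z => // m; elim/ltn_ind: m => m IHm mD.
have [/zx//|nm] := ltnP m n.
rewrite -(subnKC nm) -letter_iter zn IHm ?ltn_subrL ?n0 ?(leq_trans n0) //; last first.
  by rewrite (leq_ltn_trans (leq_subr _ _)).
by rewrite -xD ?letter_iter // ltn_subLR.
Qed.

Lemma path_point i p y : path (edge A) i p -> letter y 0 = last i p ->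
  exists2 x, letter x 0 = i & iter (size p) (shift_map A) x = y.
Proof.
elim: p i => [|j p IHp] i /=; first by move=> _ yi; exists y.
case/andP=> /eqP ij /IHp {}IHp /IHp[x xj xp].
pose c m := if m is m'.+1 then letter x m' else i.
have cA m : A (c m) (c m.+1) = 1%N.
  by case: m => [|m] /=; rewrite ?xj// letter_admissible.
exists (point_of cA) => //; rewrite -iterS iterSr -xp; congr (iter _ _ _).
exact: letter_inj.
Qed.

Lemma simple_return_point j s : simple_return A j s ->
  exists z, [/\ letter z 0 = j, letter z (size s).+1 = j &
    forall m, (m < size s)%N -> letter z m.+1 = nth j s m].
Proof.
case/andP=> /(pathP j) sA js.
have [//|m|/=|z zs zc] := @periodize (nth j (j :: rcons s j)) (size s).+1.
- by rewrite -[(size s).+1](size_rcons s j) => /sA /eqP.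
- by rewrite nth_rcons ltnn eqxx.
exists z; split; first by rewrite zc.
- by rewrite -[_.+1]addn0 -letter_iter zs zc.
- by move=> m ms; rewrite zc //= nth_rcons ms.
Qed.

(* Two infinite concatenations of distinct first-return words are told apart by
   their first return time and the letters before it. *)
Lemma no_isolated_point : condition_I A ->
  forall x n, exists2 y, agree n x y & y <> x.
Proof.
move=> AI x n; have [j [/connectP[p pA jp] [s [t [st sR tR]]]]] := AI (letter x n).
have [ws [ws0 wsS wsE]] := simple_return_point sR.
have [wt [wt0 wtS wtE]] := simple_return_point tR.
have ext w : letter w 0 = j ->
    exists2 y, agree n x y & iter (size p) (shift_map A) (iter n (shift_map A) y) = w.
  rewrite jp => /(path_point pA)[v /esym v0 vw].
  by have [y xy yv] := splice v0; exists y => //; rewrite yv.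
have [ys xys yws] := ext _ ws0; have [yt xyt ywt] := ext _ wt0.
have [ysx|] := pselect (ys = x); last by exists ys.
have [ytx|] := pselect (yt = x); last by exists yt.
have ww : ws = wt by rewrite -yws -ywt ysx ytx.
have ne (r : seq 'I_N) (q : nat) : j \notin r -> (q < size r)%N -> nth j r q <> j.
  by move=> jr /(mem_nth j) /[swap] ->; apply/negP.
have [/andP[_ js] /andP[_ jt]] := (sR, tR).
have sz : size s = size t.
  case: (ltngtP (size s) (size t)) => // lt; exfalso.
    by apply: (ne _ _ jt lt); rewrite -wtE // -ww wsS.
  by apply: (ne _ _ js lt); rewrite -wsE // ww wtS.
case/negP: st; apply/eqP; apply: (@eq_from_nth _ j) => // q qs.
by rewrite -wsE // ww wtE // -sz.
Qed.

(** If [p < q], every letter from position [q] on repeats an earlier one, so the first [maxn n q]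
    letters determine the point and [x] would be isolated. *)
Lemma iter_shift_eq_open x n p q : condition_I A ->
  (forall y, agree n x y -> iter p (shift_map A) y = iter q (shift_map A) y) ->
  p = q.
Proof.
move=> AI; wlog pq : p q / (p < q)%N => [wl|] xpq.
  case: (ltngtP p q) => [lt|lt|//]; first exact: wl xpq.
  by apply/esym; apply: wl lt _ => y /xpq.
have [y xy yx] := no_isolated_point AI x (maxn n q).
case: yx; apply: letter_inj => m; elim/ltn_ind: m => m IHm.
have [mq|qm] := ltnP m q; first by apply: xy; rewrite leq_max mq orbT.
have shift_back z : agree n x z -> letter z m = letter z (p + (m - q))%N.
  by move=> /xpq e; rewrite -letter_iter e letter_iter subnKC.
rewrite !shift_back ?IHm //; first by lia.
by move=> r rn; apply: xy; rewrite leq_max rn.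
Qed.

End shift_points.

(** * Cylinders as a neighbourhood base *)

Section shift_topology.
Context {N : nat} {A : 'M[nat]_N}.
Implicit Types x y z : shift_space A.

Lemma agree_trans n x y z : agree n x y -> agree n y z -> agree n x z.
Proof. by move=> xy yz m mn; rewrite yz // xy. Qed.

Lemma agree_le m n x y : (m <= n)%N -> agree n x y -> agree m x y.
Proof. by move=> mn xy i im; apply: xy; exact: leq_trans mn. Qed.

Lemma near_agree n x : \forall y \near x, agree n x y.
Proof.
elim: n => [|n IHn]; first by apply: filterE => y m; rewrite ltn0.
have cn : continuous (fun y : shift_space A => (val y : seq_space) n).
  move=> y.
  exact: continuous_comp (shift_space_val_cts (x := y)) (coord_cts (n := n) (x := _)).
apply: filterS2 IHn (continuous_discrete (D := discrete_topology 'I_N) x cn).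
by move=> y xy yn m; rewrite ltnS leq_eqVlt => /predU1P[->//|/xy].
Qed.

(** The sets that contain a cylinder of the full sequence space around [x] form a filter; it
    converges to [x] coordinatewise, hence in the product topology. *)
Lemma nbhs_agree x (U : set (shift_space A)) :
  nbhs x U -> exists n, forall y, agree n x y -> U y.
Proof.
pose F : set_system (@seq_space N) :=
  fun V =>
  exists n, forall y : @seq_space N,
    (forall m, (m < n)%N -> y m = (val x : seq_space) m) -> V y.
have FF : Filter F.
  split; first by exists 0%N.
  - move=> P Q [m mP] [n nQ]; exists (maxn m n) => y xy.
    by split; [apply: mP|apply: nQ] => r rm; apply: xy; rewrite leq_max rm ?orbT.
  - by move=> P Q PQ [n nP]; exists n => y /nP /PQ.
have Fx : F --> (val x : seq_space).
  apply/cvg_sup => n U' [V [[W oW <-]] Wfx VU].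
  by exists n.+1 => y /(_ n (ltnSn n)) yx; apply: VU; rewrite /= yx.
case=> W [[O oO <-] /= Ox OU].
have [n nO] := Fx O (open_nbhs_nbhs (conj oO Ox)).
by exists n => y xy; apply: OU; exact: nO.
Qed.

End shift_topology.

(** * Continuity and local constancy of Birkhoff sums *)

Lemma near_agree_im {N M : nat} {A : 'M[nat]_N} {B : 'M[nat]_M}
    (h : cfun (shift_space A) (shift_space B)) n x :
  \forall y \near x, agree n (h x) (h y).
Proof. exact: (cfun_cts (f := h) (x := x) (near_agree n (h x))). Qed.

Lemma near_nat_eq {X : topologicalType} (k : cfun X nat) x :
  \forall y \near x, k y = k x.
Proof. exact: (continuous_discrete x (cfun_cts (f := k))). Qed.

Definition iter_cfun {X : topologicalType} (s : cfun X X) n : cfun X X :=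
  iter n (fun g => cfun_comp s g) (mkcfun (fun x => cvg_id : id @ x --> id x)).

Lemma iter_cfunE {X : topologicalType} (s : cfun X X) n x :
  iter_cfun s n x = iter n s x.
Proof. by elim: n => //= n <-. Qed.


Lemma bsum_cts {X Y : topologicalType} {V : topologicalZmodType}
    (s : cfun Y Y) (f : cfun Y V) (n : cfun X nat) (g : cfun X Y) :
  continuous (fun x => bsum s f (n x) (g x)).
Proof.
move=> x U /= Ux.
(* The length is frozen at [n x]. As [n] is locally constant, the function coincides near [x] with
   this finite sum of continuous functions. *)
pose F : cfun X V :=
  \sum_(0 <= i < n x) cfun_comp f (cfun_comp (iter_cfun s i) g).
have FE y : F y = bsum s f (n x) (g y).
  rewrite /F /bsum; elim: (n x) => [|m IHm]; first by rewrite !big_geq.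
  by rewrite !big_nat_recr //= -IHm cfunD !cfun_compE iter_cfunE.
have FU : nbhs x (F @^-1` U) by apply: (cfun_cts (f := F)); rewrite FE.
by apply: filterS2 FU (near_nat_eq n x) => y /=; rewrite FE => + ->.
Qed.

(** Needed for the exponents, whose values in [nat] do not form a topological abelian group as
    [bsum_cts] demands. *)
Lemma near_bsum {X Y : topologicalType} (s : cfun Y Y) (f : cfun Y nat)
    (n : cfun X nat) (g : cfun X Y) x :
  \forall y \near x, bsum s f (n y) (g y) = bsum s f (n x) (g x).
Proof.
suff H : \forall y \near x, bsum s f (n x) (g y) = bsum s f (n x) (g x).
  by apply: filterS2 H (near_nat_eq n x) => y + ->.
elim: (n x) => [|m IHm]; first by apply: filterE => y; rewrite !bsum0.
pose fm := cfun_comp f (cfun_comp (iter_cfun s m) g).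
apply: filterS2 IHm (near_nat_eq fm x) => y; rewrite !bsumSr => ->.
by rewrite !cfun_compE !iter_cfunE => ->.
Qed.

(** * Inversion and periodic points under an orbit equivalence *)

Section orbit_equivalence.
Context {N M : nat} {A : 'M[nat]_N} {B : 'M[nat]_M}.
Context {h : cfun (shift_space A) (shift_space B)}.
Context {h' : cfun (shift_space B) (shift_space A)}.
Context {k1 l1 : cfun (shift_space A) nat} {k2 l2 : cfun (shift_space B) nat}.
Local Notation sA := (shift_map A).
Local Notation sB := (shift_map B).
Hypothesis A_I : condition_I A.
Hypothesis hK : cancel h h'.
Hypothesis hkl1 : orbit_cocycles sA sB h k1 l1.
Hypothesis hkl2 : orbit_cocycles sB sA h' k2 l2.

(* The cocycle sums are locally constant and compute two exponents p, q with
   sA^p x = sA^q x, so they agree as [X_A] has no isolated points. *)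
Lemma orbit_cocycles_inverse x :
  (bsum sB l2 (l1 x) (h x) + bsum sB k2 (k1 x) (h (sA x)) =
   (bsum sB l2 (k1 x) (h (sA x)) + bsum sB k2 (l1 x) (h x)).+1)%N.
Proof.
have hs s f n := near_bsum s f n (cfun_comp h sA).
have [n nE] := nbhs_agree (filterI
  (filterI (near_bsum sB l2 l1 h x) (hs sB k2 k1 x))
  (filterI (hs sB l2 k1 x) (near_bsum sB k2 l1 h x))).
apply: (iter_shift_eq_open (x := x) (n := n) A_I) => y /nE[[<- <-] [<- <-]].
(* Both identities start from the point [h' (iter (l1 y) sB (h y))]; one leads to the orbit of [y],
   the other to that of [sA y], whence the successor in the goal. *)
have eL := orbit_cocycles_iter hkl2 (l1 y) (h y).
have eK := orbit_cocycles_iter hkl2 (k1 y) (h (sA y)).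
rewrite hK in eL; rewrite hK hkl1 in eK.
by rewrite addnC iterD -eL -iterD addnC iterD eK -iterD -iterSr addnC.
Qed.

(** Expansion leaves Birkhoff sums of [g] from [x], from [sA x], and two from [z]. Prolonging them
    along common orbits with [shift_sum] makes the sums from [z] cancel; by [orbit_cocycles_inverse]
    the sum from [x] is then one term longer than that from [sA x], and this term is [g x]. *)
Lemma PsiK {V : zmodType} (g : shift_space A -> V) :
  Psi sA sB h k1 l1 (Psi sB sA h' k2 l2 g) =1 g.
Proof.
move=> x; rewrite PsiE !bsum_Psi // !hK hkl1.
have eL := orbit_cocycles_iter hkl2 (l1 x) (h x).
have eK := orbit_cocycles_iter hkl2 (k1 x) (h (sA x)).
rewrite hK in eL; rewrite hK hkl1 in eK.
have := orbit_cocycles_inverse x; move: eL eK.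
set z := h' _; set a := bsum sB l2 (l1 x) _; set b := bsum sB k2 (l1 x) _.
set a' := bsum sB l2 (k1 x) _; set b' := bsum sB k2 (k1 x) _ => eL eK pq.
have shift_sum c d e w : iter d sA z = iter c sA w ->
    bsum sA g c w - bsum sA g d z =
    bsum sA g (c + e)%N w - bsum sA g (d + e)%N z.
  by move=> zw; rewrite !bsumD zw opprD addrACA subrr addr0.
rewrite (shift_sum _ _ b' _ eL) (shift_sum _ _ b _ eK) pq bsumS (addnC b').
by rewrite opprB addrA addrNK addrK.
Qed.

(* For [u] near [z] let [v] near [z] be its preimage under sA^n; were [k1 > l1]
   along the periodic orbit, each coordinate of [h u] would be an earlier
   coordinate of [h v], so [h] would be constant near [z]. *)
Lemma periodic_cocycle_ge0 n z : (0 < n)%N -> iter n sA z = z ->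
  (bsum sA k1 n z <= bsum sA l1 n z)%N.
Proof.
move=> n0 zn; rewrite leqNgt; apply/negP.
set L := bsum _ l1 n z; set K := bsum _ k1 n z => LK.
have near_z (f : cfun (shift_space A) nat) :
    \forall u \near z, bsum sA f n u = bsum sA f n z.
  exact: near_bsum sA f (cfun_cst n) (mkcfun (fun x => cvg_id : id @ x --> id x)) z.
have [E zE] := nbhs_agree (filterI (near_agree_im h K z)
  (filterI (near_z k1) (near_z l1))).
(* With [E.+1] in place of [E], position [0] is always covered; [splice] needs this common letter to
   put the first [n] letters of [z] in front of [u]. *)
have hE q u : agree E.+1 z u -> letter (h u) q = letter (h z) q.
  elim/ltn_ind: q u => q IHq u zu.
  have [qK|Kq] := ltnP q K; first by have [/(_ q qK)] := zE u (agree_le (leqnSn E) zu).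
  have [|v zv vn] := @splice _ _ z u n.
    by rewrite -[n]addn0 -letter_iter zn zu.
  have {}zv : agree E.+1 z v.
    move=> m mE; have [/zv//|nm] := ltnP m n.
    rewrite -(subnKC nm) -!letter_iter vn zn zu //.
    exact: leq_ltn_trans (leq_subr _ _) mE.
  have [_ [kv lv]] := zE v (agree_le (leqnSn E) zv).
  have := orbit_cocycles_iter hkl1 n v; rewrite vn kv lv -/K -/L => huv.
  have := orbit_cocycles_iter hkl1 n z; rewrite zn -/K -/L => hzz.
  rewrite -(subnKC Kq) -!letter_iter huv hzz !letter_iter.
  by apply: IHq => //; rewrite -[ltnRHS](subnKC Kq) ltn_add2r.
have [u /hE zu] := no_isolated_point A_I z E.+1.
by case; apply: (can_inj hK); apply: letter_inj => q; exact: zu.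
Qed.

End orbit_equivalence.

Lemma compact_cfun_nat_bounded {X : compactSpaceType} (k : cfun X nat) :
  exists C, forall x, (k x <= C)%N.
Proof.
have := compact_near_coveringP [set: X].
case=> /(_ compact_space) /(_ nat \oo (fun C x => (k x <= C)%N)) cov _.
have [x _|C _ kC] := cov _.
  exists ([set y | k y = k x], [set C | (k x <= C)%N]).
    by split; [exact: near_nat_eq|exists (k x)].
  by case=> y C /= [-> ->].
by exists C => x; exact: (kC C (leqnn C) x I).
Qed.

(** * Lower bounds for Birkhoff sums from periodic orbits *)

Section birkhoff_lower_bound.
Context {N : nat} {A : 'M[nat]_N} {R : realFieldType}.
Variables (F : shift_space A -> R) (e M : R) (D : nat).
Hypothesis D0 : (0 < D)%N.
Hypothesis e0 : 0 <= e.
Hypothesis M0 : 0 <= M.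
Hypothesis F_modulus : forall x y, agree D x y -> F x <= F y + e.
Hypothesis F_lb : forall x, - M <= F x.
Hypothesis F_periodic : forall n z, (0 < n)%N ->
  iter n (shift_map A) z = z -> 0 <= bsum (shift_map A) F n z.
Local Notation s := (shift_map A).

(** A periodic point shadows the returning segment with agreement of length [D] at each of the [n]
    times, so each term changes by at most [e]. *)
Lemma bsum_return_ge n x : agree D x (iter n s x) ->
  - (n%:R * e) <= bsum s F n x.
Proof.
case: n => [|n] xn; first by rewrite bsum0 mul0r oppr0.
have [z zn xz] := periodic_shadow (ltn0Sn n) D0 xn.
have := F_periodic (ltn0Sn n) zn; rewrite lerNl => z0.
suff : bsum s F n.+1 z <= bsum s F n.+1 x + n.+1%:R * e by lra.
rewrite mulr_natl -[X in _ *+ X]card_ord -sumr_const /bsum !big_mkord -big_split /=.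
apply: ler_sum => i _; apply: F_modulus => m mD; rewrite !letter_iter xz //.
by have := ltn_ord i; lia.
Qed.

(** Tuples form a finite type, so the blocks still available to an orbit can be counted. *)
Let block (x : shift_space A) : D.-tuple 'I_N := [tuple letter x i | i < D].

Let block_agree x y : block x = block y -> agree D x y.
Proof.
move=> xy m mD; have := congr1 (fun t => tnth t (Ordinal mD)) xy.
by rewrite !tnth_mktuple.
Qed.

(* Cut an orbit segment after its last visit to the block it starts in: the sum
   up to that visit is controlled by periodic orbits, and the rest of the
   segment avoids that block. *)
Lemma bsum_blocks_ge q (Q : {set D.-tuple 'I_N}) n x : (#|Q| <= q)%N ->
  (forall i, (i < n)%N -> block (iter i s x) \in Q) ->
  - (n%:R * e + q%:R * M) <= bsum s F n x.
Proof.
elim: q Q n x => [|q IHq] Q [|n] x Qq nQ; rewrite ?bsum0 ?oppr_le0 ?mul0r ?add0r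
  ?mulr_ge0 //.
  by move: Qq (nQ 0%N isT); rewrite leqn0 cards_eq0 => /eqP ->; rewrite inE.
pose P j := (j <= n)%N && (block (iter j s x) == block x).
have exP : exists j, P j by exists 0%N; rewrite /P /= eqxx.
have ubP j : P j -> (j <= n)%N by case/andP.
case: (ex_maxnP exP ubP) => j /andP[jn /eqP jx] jmax.
have jret := bsum_return_ge (block_agree (esym jx)).
have Qq' : (#|Q :\ block x| <= q)%N.
  by move: Qq; rewrite (cardsD1 (block x)) (nQ 0%N isT : block x \in Q).
have /(IHq _ _ _ Qq') : forall i, (i < n - j)%N ->
    block (iter i s (iter j.+1 s x)) \in Q :\ block x.
  move=> i inj; rewrite -iterD !inE nQ ?andbT; last by lia.
  apply/negP => /eqP ix; have : (i + j.+1 <= j)%N; last by lia.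
  by apply: jmax; rewrite /P ix eqxx andbT; lia.
have -> : n.+1 = (j + (n - j).+1)%N by lia.
(* The term at the last visit itself is covered by neither bound; it costs the one [M] charged to
   the removed block. *)
have := F_lb (iter j s x).
rewrite bsumD bsumS -iterS natrD -!natr1 !mulrDl !mul1r.
move: jret e0; move: (_ * e) (_ * e) (_ * M) (F _) (bsum _ _ _ _) (bsum _ _ _ _).
move=> a b c d f g; lra.
Qed.

Lemma bsum_lower_bound :
  exists C, forall n x, - (n%:R * e + C) <= bsum s F n x.
Proof.
exists (#|{: D.-tuple 'I_N}|%:R * M) => n x.
by apply: (@bsum_blocks_ge _ finset.setT) => [|i _]; rewrite ?max_card ?inE.
Qed.

End birkhoff_lower_bound.

(** * The maps [Psi] as operators between spaces of continuous functions *)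

Section cfun_Psi.
Context {X Y : topologicalType} (sX : cfun X X) (sY : cfun Y Y) (h : cfun X Y).
Context (k l : cfun X nat).

(** The generality in [V] lets one construction give both the integral map and its complex
    extension. *)
Definition cfun_Psi {V : topologicalZmodType} (f : cfun Y V) : cfun X V :=
  mkcfun (bsum_cts (s := sY) (f := f) (n := l) (g := h)) -
  mkcfun (bsum_cts (s := sY) (f := f) (n := k) (g := cfun_comp h sX)).

Lemma cfun_PsiE {V : topologicalZmodType} (f : cfun Y V) x :
  cfun_Psi f x = Psi sX sY h k l f x.
Proof. by []. Qed.

Lemma cfun_PsiB {V : topologicalZmodType} : zmod_morphism (@cfun_Psi V).
Proof.
move=> f g; apply/cfunP => x; rewrite [RHS]cfunB !cfun_PsiE !PsiE /bsum.
by rewrite !sumrB !opprD !opprK addrACA.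
Qed.

HB.instance Definition _ (V : topologicalZmodType) :=
  GRing.isZmodMorphism.Build (cfun Y V) (cfun X V) (@cfun_Psi V) cfun_PsiB.

Lemma cfun_PsiZ {K : numFieldType} {V : topologicalLmodType K} :
  scalable (@cfun_Psi V).
Proof.
move=> a f; apply/cfunP => x; rewrite [RHS]cfunZ !cfun_PsiE !PsiE /bsum.
by rewrite scalerBr !scaler_sumr.
Qed.

HB.instance Definition _ (K : numFieldType) (V : topologicalLmodType K) :=
  GRing.isScalable.Build K (cfun Y V) (cfun X V) *:%R (@cfun_Psi V) cfun_PsiZ.

End cfun_Psi.

Section cfun_Psi_complex.
Context {R : realType} {X Y : compactSpaceType}.
Context (sX : cfun X X) (sY : cfun Y Y) (h : cfun X Y) (k l : cfun X nat).
Local Notation PsiC := (@cfun_Psi _ _ sX sY h k l R[i]^o).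

Lemma cfun_Psi_continuous : continuous PsiC.
Proof.
have [C1 kC] := compact_cfun_nat_bounded k.
have [C2 lC] := compact_cfun_nat_bounded l.
apply: bounded_linear_continuous; apply/linear_boundedP.
(* The two Birkhoff sums have at most [C2] and [C1] terms, each bounded by the supremum norm of
   [f]. *)
exists (C2 + C1)%:R; split; first exact: realn.
move=> r /ltW Cr f; apply: sup_norm_le => [|x].
  by rewrite mulr_ge0 // (le_trans _ Cr).
have bsum_le n (C : nat) y : (n <= C)%N ->
    `|bsum sY f n y : R[i]| <= C%:R * sup_norm f.
  move=> nC; rewrite /bsum big_mkord.
  apply: le_trans (ler_norm_sum _ _ _) _.
  apply: le_trans (ler_sum _ (fun i _ => le_sup_norm f _)) _.
  by rewrite sumr_const card_ord mulr_natl ler_wpMn2l ?sup_norm_ge0.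
rewrite cfun_PsiE PsiE; apply: le_trans (ler_normB _ _) _.
apply: le_trans (lerD (bsum_le _ _ _ (lC x)) (bsum_le _ _ _ (kC x))) _.
by rewrite -mulrDl -natrD ler_wpM2r ?sup_norm_ge0.
Qed.

Lemma cfun_Psi_intr (f : cfun Y int) :
  PsiC (cfun_intr f) = cfun_intr (cfun_Psi sX sY h k l f).
Proof.
apply/cfunP => x; rewrite [RHS]/= !cfun_PsiE !PsiE /bsum /=.
by rewrite [RHS]rmorphB !rmorph_sum.
Qed.

Lemma invariant_cfun_Psi (phi : {linear cfun X R[i]^o -> R[i]^o}) :
  orbit_cocycles sX sY h k l -> invariant_functional sX phi ->
  invariant_functional sY (phi \o PsiC).
Proof.
move=> hkl phi_inv f; apply/eqP; rewrite eq_sym -subr_eq0 /= -!raddfB /=.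
have -> : cfun_Psi sX sY h k l (f - cfun_comp f sY) =
    cfun_comp f h - cfun_comp (cfun_comp f h) sX.
  by rewrite raddfB; apply/cfunP => x; exact: (Psi_comp hkl f x).
by rewrite raddfB /= phi_inv subrr.
Qed.

(** The image of the constant [1] is [l - k], which by hypothesis differs from [1] by a coboundary;
    an invariant functional vanishes on coboundaries. *)
Lemma cfun_Psi_cst1 (phi : {linear cfun X R[i]^o -> R[i]^o}) :
  invariant_functional sX phi ->
  cohomology_class sX (cocycle k l) = cohomology_class sX (cfun_cst (1 : int)) ->
  phi (PsiC (cfun_cst (1 : R[i]^o))) = phi (cfun_cst (1 : R[i]^o)).
Proof.
move=> phi_inv /eqP; rewrite /cohomology_class -Quotient.idealrBE => /set_mem[xi kl].
apply/eqP; rewrite -subr_eq0 -raddfB /=.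
have -> : PsiC (cfun_cst (1 : R[i]^o)) - cfun_cst (1 : R[i]^o) =
    cfun_intr xi - cfun_comp (cfun_intr xi) sX.
  apply/cfunP => x; have /cfunP/(_ x) := kl.
  rewrite !cfunB => /(congr1 (fun n : int => n%:~R : R[i])).
  rewrite !rmorphB /= => e; rewrite -[RHS]e; congr (_ - _).
  have bsum1 n y : bsum sY (cfun_cst (1 : R[i]^o)) n y = n%:R.
    by rewrite /bsum sumr_const_nat subn0.
  exact: (congr2 (fun a b => a - b) (bsum1 _ _) (bsum1 _ _)).
by rewrite raddfB /= phi_inv subrr.
Qed.

End cfun_Psi_complex.

(** * Positivity of invariant functionals from periodic orbits *)

Section positivity.
Local Open Scope complex_scope.
Context {R : realType} {N : nat} {A : 'M[nat]_N}.
Local Notation sA := (shift_map A).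

(** Compactness makes one cylinder length serve all points; [e / 2] appears because two points are
    compared through the centre of a cylinder. *)
Lemma cfun_uniform_modulus (F : cfun (shift_space A) R[i]^o) (e : R[i]) :
  0 < e -> exists D, forall x y, agree D x y -> `|F x - F y : R[i]| < e.
Proof.
move=> e0; have e20 : 0 < e / 2%:R by rewrite divr_gt0.
pose P D x := forall y, agree D x y -> `|F x - F y : R[i]| < e.
have [/(_ (compact_space (s := shift_space A))) cov _] :=
  compact_near_coveringP [set: shift_space A].
have [x _|D _ DP] := cov _ \oo P _; last by exists D => x; exact: (DP D (leqnn D) x I).
have /cvgrPdist_lt/(_ _ e20) := cfun_cts (f := F) (x := x).
move=> /nbhs_agree[E xE].
exists ([set y | agree E x y], [set D | (E <= D)%N]).
  by split; [exact: near_agree|exists E].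
move=> [y D] /= [xy ED] z /(agree_le ED) yz.
rewrite (splitr e); apply: le_lt_trans (ler_distD (F x : R[i]) _ _) _.
by rewrite ltrD //; [rewrite distrC|]; apply: xE => //; exact: agree_trans yz.
Qed.

Lemma invariant_bsum (phi : {linear cfun (shift_space A) R[i]^o -> R[i]^o}) F n :
  invariant_functional sA phi ->
  phi (\sum_(0 <= i < n) cfun_comp F (iter_cfun sA i)) = phi F *+ n.
Proof.
move=> phi_inv; rewrite raddf_sum /= -[n in RHS]subn0 -sumr_const_nat.
apply: eq_bigr => i _; elim: i F => [|i IHi] F.
  by congr (phi _); apply/cfunP.
by rewrite -[RHS]phi_inv -[RHS]IHi; congr (phi _); apply/cfunP => x.
Qed.

Lemma complex_ge0P (z : R[i]) : 0 <= z <-> complex.Im z = 0 /\ 0 <= complex.Re z.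
Proof.
case: z => a b; rewrite lecE /=; split; first by case/andP=> /eqP ->.
by case=> -> ->; rewrite eqxx.
Qed.

(** Applying [phi] to [S_n F + n e + C >= 0] gives [n phi(F) + (n e + C) phi(1) >= 0]. A negative
    [phi F] contradicts this for a small [e] and then a large [n]. *)
Lemma invariant_ge0 (phi : {linear cfun (shift_space A) R[i]^o -> R[i]^o})
    (F : cfun (shift_space A) R[i]^o) :
  invariant_positive_measure sA phi ->
  (forall x, (F x : R[i]) \is Num.real) ->
  (forall n z, (0 < n)%N -> iter n sA z = z -> 0 <= (bsum sA F n z : R[i])) ->
  0 <= (phi F : R[i]).
Proof.
move=> [_ phi_inv phi_pos] F_real F_per.
pose f x : R := complex.Re (F x).
have FE x : F x = (f x)%:C :> R[i] by rewrite RRe_real.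
have bsumE n x : bsum sA F n x = (bsum sA f n x)%:C :> R[i].
  by rewrite /bsum rmorph_sum /=; apply: eq_bigr => i _; exact: FE.
pose M : R := complex.Re (sup_norm F).
have ME : sup_norm F = M%:C by [].
have f_lb x : - M <= f x.
  have := le_sup_norm F x; rewrite FE ME normc_def /= expr0n addr0 sqrtr_sqr lecR.
  by rewrite ler_norml => /andP[].
have M0 : 0 <= M by have := sup_norm_ge0 F; rewrite ME lecR.
have per n z : (0 < n)%N -> iter n sA z = z -> 0 <= bsum sA f n z.
  by move=> n0 zn; have := F_per n z n0 zn; rewrite bsumE lecR.
pose one : cfun (shift_space A) R[i]^o := cfun_cst (1 : R[i]^o).
have /complex_ge0P[one_im one_re] : 0 <= (phi one : R[i]).
  by apply: phi_pos => x; exact: ler01.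
have bound (e : R) : 0 < e -> exists C : R, forall n,
    0 <= (phi F : R[i]) *+ n + (n%:R * e + C)%:C * (phi one : R[i]).
  move=> e0; have [|D FD] := @cfun_uniform_modulus F e%:C; first by rewrite ltcR.
  (* [D.+1] keeps the block length positive, as shadowing requires. *)
  have f_mod x y : agree D.+1 x y -> f x <= f y + e.
    move=> /(agree_le (leqnSn D))/FD; rewrite !FE -rmorphB /= normc_def /=.
    by rewrite expr0n addr0 sqrtr_sqr ltcR ltr_norml => /andP[_]; lra.
  have [C CP] := bsum_lower_bound (ltn0Sn D) (ltW e0) M0 f_mod f_lb per.
  exists C => n.
  pose G : cfun (shift_space A) R[i]^o :=
    \sum_(0 <= i < n) cfun_comp F (iter_cfun sA i) + (n%:R * e + C)%:C *: one.
  suff : 0 <= (phi G : R[i]) by rewrite /G raddfD /= linearZ /= invariant_bsum.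
  apply: phi_pos => x.
  have -> : G x = (bsum sA f n x + (n%:R * e + C))%:C :> R[i].
    rewrite [RHS]rmorphD /= -bsumE /G cfunD; congr (_ + _); last exact: mulr1.
    rewrite /bsum; elim: (n) => [|m IHm]; first by rewrite !big_geq.
    by rewrite !big_nat_recr //= -IHm cfunD cfun_compE iter_cfunE.
  by rewrite lecR -lerBlDr sub0r.
move: (phi F : R[i]) (phi one : R[i]) one_im one_re bound.
case=> a a' [b b'] /= -> b0 bound; apply/complex_ge0P => /=.
have {}bound (e : R) : 0 < e -> exists C : R, forall n : nat,
    a' *+ n = 0 /\ 0 <= a *+ n + (n%:R * e + C) * b.
  move=> /bound[C CP]; exists C => n.
  have /complex_ge0P := CP n; rewrite !raddfD !raddfMn /=.
  by rewrite !(mulr0, addr0, mul0r, subr0).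
split; first by have [C /(_ 1%N)[]] := bound 1 ltr01.
rewrite leNgt; apply/negP => a0.
(* The choice [e = - a / (2 * (b + 1))] gives [e * b <= - a / 2], also when [b = 0]; then [n] is
   taken so large that [C1 * b] is below [n] times the remaining [- a / 2]. *)
have b1 : 0 < 2 * (b + 1) by lra.
have [|C1 CP] := bound (- a / (2 * (b + 1))); first by rewrite divr_gt0 // oppr_gt0.
have [_] := CP (Num.truncn (C1 * b / (- a / 2))).+1.
set n := _.+1.
have : C1 * b / (- a / 2) < n%:R by exact: truncnS_gt.
rewrite ltr_pdivrMr; last by lra.
have : - a / (2 * (b + 1)) * b <= - a / 2.
  by rewrite mulrAC ler_pdivrMr //; nra.
move: (_ / (2 * _)) => e eb nC; rewrite -mulr_natl mulrDl -mulrA.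
have n0 : 0 <= n%:R :> R by exact: ler0n.
by nra.
Qed.

End positivity.

(** * Transport of invariant measures *)

(** Over a period both Birkhoff sums start at [h z], and the subtracted one is no longer than the
    other, so their difference is a sum of values of [f]. *)
Lemma Psi_positive {R : realType} {N M : nat} {A : 'M[nat]_N} {B : 'M[nat]_M}
    {h : cfun (shift_space A) (shift_space B)}
    {h' : cfun (shift_space B) (shift_space A)} {k l : cfun (shift_space A) nat}
    (phi : {linear cfun (shift_space A) R[i]^o -> R[i]^o}) :
  condition_I A -> cancel h h' ->
  orbit_cocycles (shift_map A) (shift_map B) h k l ->
  invariant_positive_measure (shift_map A) phi ->
  positive_functional (phi \o cfun_Psi (shift_map A) (shift_map B) h k l).
Proof.
move=> A_I hK hkl phi_pos f f0.
have bsum0 n y : 0 <= (bsum (shift_map B) f n y : R[i]) by apply: sumr_ge0.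
apply: (invariant_ge0 phi_pos) => [x|n z n0 zn].
  by rewrite cfun_PsiE PsiE rpredB // ger0_real.
rewrite (bsum_Psi hkl f n z : bsum _ (cfun_Psi _ _ _ _ _ f) n z = _) zn.
rewrite -(subnKC (periodic_cocycle_ge0 A_I hK hkl n0 zn)) bsumD.
by rewrite addrAC subrr add0r.
Qed.

Lemma invariant_positive_cfun_Psi {R : realType} {N M : nat}
    {A : 'M[nat]_N} {B : 'M[nat]_M}
    {h : cfun (shift_space A) (shift_space B)}
    {h' : cfun (shift_space B) (shift_space A)} {k l : cfun (shift_space A) nat}
    (phi : {linear cfun (shift_space A) R[i]^o -> R[i]^o}) :
  condition_I A -> cancel h h' ->
  orbit_cocycles (shift_map A) (shift_map B) h k l ->
  invariant_positive_measure (shift_map A) phi ->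
  invariant_positive_measure (shift_map B)
    (phi \o cfun_Psi (shift_map A) (shift_map B) h k l).
Proof.
move=> A_I hK hkl phi_pm; have [phi_cts phi_inv _] := phi_pm; split.
- move=> f; apply: continuous_comp; last exact: phi_cts.
  exact: cfun_Psi_continuous.
- exact: invariant_cfun_Psi.
- exact: Psi_positive.
Qed.

Theorem theorem7p2 (R : realType) (N M : nat) (A : 'M[nat]_N) (B : 'M[nat]_M)
    (N_gt1 : (1 < N)%N) (M_gt1 : (1 < M)%N)
    (A01 : zero_one_mx A) (B01 : zero_one_mx B)
    (A_irr : irreducible_mx A) (B_irr : irreducible_mx B)
    (A_I : condition_I A) (B_I : condition_I B)
    (h : cfun (shift_space A) (shift_space B))
    (h' : cfun (shift_space B) (shift_space A))
    (hK : cancel h h') (h'K : cancel h' h)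
    (k1 l1 : cfun (shift_space A) nat) (k2 l2 : cfun (shift_space B) nat)
    (hkl1 : orbit_cocycles (shift_map A) (shift_map B) h k1 l1)
    (hkl2 : orbit_cocycles (shift_map B) (shift_map A) h' k2 l2) :
  exists (PsiZ : {additive cfun (shift_space B) int -> cfun (shift_space A) int})
         (PsiZ' : {additive cfun (shift_space A) int -> cfun (shift_space B) int})
         (PsiC : {linear cfun (shift_space B) R[i]^o -> cfun (shift_space A) R[i]^o})
         (PsiC' : {linear cfun (shift_space A) R[i]^o -> cfun (shift_space B) R[i]^o}),
    (* the group isomorphisms given by the defining formulas *)
    [/\ forall f x, PsiZ f x = Psi (shift_map A) (shift_map B) h k1 l1 f x,
        forall g y, PsiZ' g y = Psi (shift_map B) (shift_map A) h' k2 l2 g y,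
        cancel PsiZ PsiZ' & cancel PsiZ' PsiZ] /\
    (* their extensions, given by the same formulas *)
    [/\ forall f, PsiC (cfun_intr f) = cfun_intr (PsiZ f),
        forall g, PsiC' (cfun_intr g) = cfun_intr (PsiZ' g),
        forall f x, PsiC f x = Psi (shift_map A) (shift_map B) h k1 l1 f x &
        forall g y, PsiC' g y = Psi (shift_map B) (shift_map A) h' k2 l2 g y] /\
    [/\ continuous PsiC, continuous PsiC',
        cancel PsiC PsiC' & cancel PsiC' PsiC] /\
    ((forall phi : {linear cfun (shift_space A) R[i]^o -> R[i]^o},
        invariant_positive_measure (shift_map A) phi ->
        invariant_positive_measure (shift_map B) (phi \o PsiC)) /\
     (forall psi : {linear cfun (shift_space B) R[i]^o -> R[i]^o},
        invariant_positive_measure (shift_map B) psi ->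
        invariant_positive_measure (shift_map A) (psi \o PsiC'))) /\
    ((cohomology_class (shift_map A) (cocycle k1 l1) =
        cohomology_class (shift_map A) (cfun_cst (1 : int)) ->
      forall phi : {linear cfun (shift_space A) R[i]^o -> R[i]^o},
        invariant_probability_measure (shift_map A) phi ->
        invariant_probability_measure (shift_map B) (phi \o PsiC)) /\
     (cohomology_class (shift_map B) (cocycle k2 l2) =
        cohomology_class (shift_map B) (cfun_cst (1 : int)) ->
      forall psi : {linear cfun (shift_space B) R[i]^o -> R[i]^o},
        invariant_probability_measure (shift_map B) psi ->
        invariant_probability_measure (shift_map A) (psi \o PsiC'))).
Proof.
(* All four maps are instances of [cfun_Psi], with [V] equal to [int] for the first two and to
   [R[i]^o] for the others. *)
exists (cfun_Psi (shift_map A) (shift_map B) h k1 l1).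
exists (cfun_Psi (shift_map B) (shift_map A) h' k2 l2).
exists (cfun_Psi (shift_map A) (shift_map B) h k1 l1).
exists (cfun_Psi (shift_map B) (shift_map A) h' k2 l2).
have PsiAK := PsiK A_I hK hkl1 hkl2; have PsiBK := PsiK B_I h'K hkl2 hkl1.
split; first by split=> // f; apply/cfunP => x; [exact: PsiBK|exact: PsiAK].
split; first by split=> // f; exact: cfun_Psi_intr.
split.
  split=> [||f|f]; [exact: cfun_Psi_continuous|exact: cfun_Psi_continuous| |].
    by apply/cfunP => x; exact: PsiBK.
  by apply/cfunP => x; exact: PsiAK.
split; first by split=> phi; exact: invariant_positive_cfun_Psi.
split=> c1 phi [phi_pm phi1].
- split; first exact: invariant_positive_cfun_Psi A_I hK hkl1 phi_pm.
  by have [_ phi_inv _] := phi_pm; rewrite /= cfun_Psi_cst1.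
- split; first exact: invariant_positive_cfun_Psi B_I h'K hkl2 phi_pm.
  by have [_ phi_inv _] := phi_pm; rewrite /= cfun_Psi_cst1.
Qed.
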